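(* Let $T>0$, $\mu\ge0$, $s>0$, $x_0\in\mathbb{R}^n$, and let $f:\mathbb{R}^n\to\mathbb{R}$ be continuously differentiable, $\mu$-strongly convex (possibly $\mu=0$) and $(1/s)$-smooth, with a minimizer $x^*$. Let $X:[0,T]\to\mathbb{R}^n$ be the solution to the unified NAG-G ODE $$\ddot X+\left(\frac{\sqrt\mu}{2}\tanh\left(\frac{\sqrt\mu}{2}(T-t)\right)+\frac{3}{T-t}\operatorname{cothc}\left(\frac{\sqrt\mu}{2}(T-t)\right)\right)\dot X+\nabla f(X)=0$$ with $X(0)=x_0$, $\dot X(0)=0$. Then $$\begin{aligned}\|\nabla f(X(T))\|^2&\le\frac{8}{T^2}\operatorname{cschc}^2\left(\frac{\sqrt\mu}{2}T\right)\left(f(x_0)-f(X(T))+\frac\mu2\|x_0-X(T)\|^2\right)\\&\le\frac{8}{T^2}\operatorname{cschc}^2\left(\frac{\sqrt\mu}{2}T\right)\left(f(x_0)-f(x^* )+\frac\mu2\|x_0-X(T)\|^2\right).\end{aligned}$$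
   Context: $\operatorname{sinhc}(x)=\sinh(x)/x$ for $x\ne0$, $\operatorname{sinhc}(0)=1$; $\operatorname{tanhc}(x)=\operatorname{sinhc}(x)/\cosh(x)$; $\operatorname{cothc}(x)=1/\operatorname{tanhc}(x)$; $\operatorname{cschc}(x)=1/\operatorname{sinhc}(x)$. $f$ is $\mu$-strongly convex if $f(y)\ge f(x)+\langle\nabla f(x),y-x\rangle+\frac{\mu}{2}\|y-x\|^2$ for all $x,y$; $f$ is $L$-smooth if $\nabla f$ is $L$-Lipschitz. The ODE holds on $[0,T)$, where the solution is unique; the solution is extended continuously to $t=T$, and $X(T)$ denotes the value of this extension (with $\dot X(T)=0$ and $\ddot X(T)=\lim_{t\to T^-}\frac{\dot X(t)}{t-T}=\frac12\nabla f(X(T))$). *)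

(* Defs.v *)
From mathcomp Require Import all_boot all_order all_algebra.
From mathcomp Require Import all_classical all_reals all_analysis.

Set Implicit Arguments.
Unset Strict Implicit.
Unset Printing Implicit Defensive.

Import Order.TTheory GRing.Theory Num.Theory.
Import numFieldNormedType.Exports.

Local Open Scope classical_set_scope.
Local Open Scope ring_scope.

Definition sinh (R : realType) (x : R) : R := (expR x - expR (- x)) / 2.
Definition cosh (R : realType) (x : R) : R := (expR x + expR (- x)) / 2.
Definition tanh (R : realType) (x : R) : R := sinh x / cosh x.

Definition sinhc (R : realType) (x : R) : R :=
  if x == 0 then 1 else sinh x / x.
Definition tanhc (R : realType) (x : R) : R := sinhc x / cosh x.
Definition cothc (R : realType) (x : R) : R := 1 / tanhc x.
Definition cschc (R : realType) (x : R) : R := 1 / sinhc x.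

(* The library norm [`|u|] on ['rV[R]_n] is the sup norm, hence a separate
   Euclidean norm for all metric statements.  Topological notions (limits,
   continuity, differentiability) do not depend on this choice. *)
Definition dot (R : realType) (n : nat) (u v : 'rV[R]_n) : R :=
  \sum_(i < n) u 0 i * v 0 i.
Definition enorm (R : realType) (n : nat) (u : 'rV[R]_n) : R :=
  Num.sqrt (dot u u).

Definition grad (R : realType) (n : nat) (f : 'rV[R]_n -> R) (x : 'rV[R]_n) :
  'rV[R]_n := \row_(j < n) 'D_(delta_mx 0 j) f x.

Definition continuously_differentiable (R : realType) (n : nat)
    (f : 'rV[R]_n -> R) : Prop :=
  (forall x, differentiable f x) /\ continuous (grad f).

Definition strongly_convex (R : realType) (n : nat) (mu : R)
    (f : 'rV[R]_n -> R) : Prop :=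
  forall x y, f x + dot (grad f x) (y - x) + mu / 2 * enorm (y - x) ^+ 2 <= f y.

Definition smooth (R : realType) (n : nat) (L : R) (f : 'rV[R]_n -> R) : Prop :=
  forall x y, enorm (grad f y - grad f x) <= L * enorm (y - x).

Definition minimizer (R : realType) (n : nat) (f : 'rV[R]_n -> R)
    (xstar : 'rV[R]_n) : Prop :=
  forall x, f xstar <= f x.

(* Derivative at [t] relative to the domain [D]: two-sided at interior points,
   one-sided at an endpoint; values of [X] outside [D] are irrelevant. *)
Definition has_derivative_within (R : realType) (n : nat) (D : set R)
    (X : R -> 'rV[R]_n) (t : R) (v : 'rV[R]_n) : Prop :=
  (r - t)^-1 *: (X r - X t) @[r --> within D t^'] --> v.

Definition nag_g_damping (R : realType) (mu T t : R) : R :=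
  Num.sqrt mu / 2 * tanh (Num.sqrt mu / 2 * (T - t))
  + 3 / (T - t) * cothc (Num.sqrt mu / 2 * (T - t)).

(* The equation is required on [0, T[ only; the value [X T] is determined by
   continuity of [X] on [0, T].  [V] and [A] are the first and second
   derivatives of [X]. *)
Definition nag_g_solution (R : realType) (n : nat) (f : 'rV[R]_n -> R)
    (mu T : R) (x0 : 'rV[R]_n) (X : R -> 'rV[R]_n) : Prop :=
  {within `[0, T], continuous X} /\
  exists V A : R -> 'rV[R]_n,
    [/\ X 0 = x0,
        V 0 = 0,
        forall t : R, t \in `[0, T[ -> has_derivative_within `[0, T[ X t (V t),
        forall t : R, t \in `[0, T[ -> has_derivative_within `[0, T[ V t (A t) &
        forall t : R, t \in `[0, T[ ->
          A t + nag_g_damping mu T t *: V t + grad f (X t) = 0].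

(* Main.v *)
Require Import Defs.
From mathcomp Require Import all_boot all_order all_algebra.
From mathcomp Require Import all_classical all_reals all_analysis.
From mathcomp Require Import ring lra.

Set Implicit Arguments.
Unset Strict Implicit.
Unset Printing Implicit Defensive.

Import Order.TTheory GRing.Theory Num.Theory.
Import numFieldNormedType.Exports.

Local Open Scope classical_set_scope.
Local Open Scope ring_scope.

(** With q = sqrt mu / 2, S(t) = sinh (q (T - t)) / q, C(t) = cosh (q (T - t))
    and Y = X - X(T), the friction of the equation is q^2 S / C + 3 C / S, and
      E = (f(X) - f(X(T)) + |X'|^2 / 2 + 2 (C / S) <X', Y> + 2 q^2 |Y|^2) / S^2
    is a Lyapunov function: differentiating along the flow and using
    S' = - C, C' = - q^2 S and C^2 = 1 + q^2 S^2, every cross term cancels and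
      E' = 2 C / S^3 (f(X) - f(X(T)) - <grad f(X), Y> + 2 q^2 |Y|^2)
           - q^2 / (S C) |X'|^2,
    whose first bracket is nonpositive by strong convexity between X and X(T),
    because mu / 2 = 2 q^2 ([is_derive_energy], [energy_rate_le0]).  Zero
    initial velocity makes E(0) equal to
      (f(x0) - f(X(T)) + (mu / 2) |x0 - X(T)|^2) / S(0)^2,
    and T^-2 cschc (q T)^2 = S(0)^-2.

    It remains to see that the terminal value of E is at least |g|^2 / 8, where
    g = grad f(X(T)).  Since f(X) - f(X(T)) >= <g, Y>, it is enough to know
    that X' / S -> - g / 2 and Y / S^2 -> g / 4, as then the lower bound tends
    to (1/4 + 1/8 - 1/4) |g|^2.  The friction is the logarithmic derivative of
    1 / (C S^3), so that (X' / (C S^3))' = - grad f(X) / (C S^3); comparing with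
    (S^-2 / 2)' = C / S^3 and applying the rule of L'Hopital to a denominator
    that tends to infinity ([lhopital_pinfty_at_left]) gives the first limit
    with no information on X' near T ([velocity_asymptotics]).  The second one
    is the usual 0/0 rule ([displacement_asymptotics]). *)

(** * Hyperbolic functions of the remaining time *)

Lemma cosh_gt0 (R : realType) (x : R) : 0 < cosh x.
Proof. by rewrite /cosh divr_gt0// addr_gt0// expR_gt0. Qed.

Lemma cosh_sqr (R : realType) (x : R) : cosh x ^+ 2 = 1 + sinh x ^+ 2.
Proof.
have e1 : expR x * expR (- x) = 1 by rewrite -expRD subrr expR0.
rewrite /cosh /sinh.
by move: e1; move: (expR x) (expR (- x)) => a b e1; field: e1.
Qed.

Lemma sinh_gt0 (R : realType) (x : R) : 0 < x -> 0 < sinh x.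
Proof. by move=> x0; rewrite /sinh divr_gt0// subr_gt0 ltr_expR; lra. Qed.

Lemma sinhc_gt0 (R : realType) (x : R) : 0 < sinhc x.
Proof.
rewrite /sinhc; case: (ltgtP x 0) => // x0; last by rewrite divr_gt0 ?sinh_gt0.
rewrite -mulrNN -invrN divr_gt0 ?oppr_gt0//.
have := @sinh_gt0 _ (- x); rewrite oppr_gt0 => /(_ x0).
by rewrite /sinh opprK; lra.
Qed.

Lemma mul_sinhc (R : realType) (x : R) : x * sinhc x = sinh x.
Proof.
rewrite /sinhc; case: eqVneq => [->|x0]; last by field.
by rewrite /sinh mul0r oppr0 subrr mul0r.
Qed.

Section remaining_time.
Variables (R : realType) (q T : R).

Definition rem_cosh (t : R) : R := cosh (q * (T - t)).
(** This is sinh (q (T - t)) / q, written so that q = 0, where it is T - t,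
    needs no separate treatment. *)
Definition rem_sinh (t : R) : R := (T - t) * sinhc (q * (T - t)).

Lemma mul_rem_sinh t : q * rem_sinh t = sinh (q * (T - t)).
Proof. by rewrite /rem_sinh mulrA mul_sinhc. Qed.

Lemma rem_cosh_gt0 t : 0 < rem_cosh t. Proof. exact: cosh_gt0. Qed.

Lemma rem_sinh_gt0 t : t < T -> 0 < rem_sinh t.
Proof. by move=> tT; rewrite mulr_gt0 ?sinhc_gt0// subr_gt0. Qed.

Lemma rem_sinh_end : rem_sinh T = 0.
Proof. by rewrite /rem_sinh subrr mul0r. Qed.

Lemma rem_cosh_end : rem_cosh T = 1.
Proof. by rewrite /rem_cosh subrr mulr0 /cosh oppr0 expR0; lra. Qed.

Lemma rem_cosh_sqr t : rem_cosh t ^+ 2 = 1 + q ^+ 2 * rem_sinh t ^+ 2.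
Proof. by rewrite /rem_cosh cosh_sqr -mul_rem_sinh exprMn. Qed.

Lemma is_derive_expR_aff (c t : R) :
  is_derive t 1 (fun r => expR (c * (T - r))) (- c * expR (c * (T - t))).
Proof.
have h : is_derive t 1 (fun r => c * (T - r)) (- c).
  have := @is_deriveZ _ _ _ (fun r => T - r) c t 1 (-1).
  rewrite /GRing.scale /= mulrN1; apply.
  by have := @is_deriveB _ _ _ (cst T) id t 1 0 1; rewrite sub0r; apply.
have := @is_derive1_comp _ expR (fun r => c * (T - r)) t _ _
  (is_derive_expR _) h.
by rewrite /comp /= mulrC.
Qed.

Lemma is_derive_rem_cosh (t : R) :
  is_derive t 1 rem_cosh (- (q ^+ 2 * rem_sinh t)).
Proof.
have h1 := is_derive_expR_aff q t; have h2 := is_derive_expR_aff (- q) t.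
have -> : rem_cosh = 2^-1 \*: ((fun r => expR (q * (T - r))) +
                         (fun r => expR (- q * (T - r)))).
  apply/funext => r.
  by rewrite /rem_cosh /cosh /= !fctE mulNr /GRing.scale /= mulrC.
apply: is_derive_eq.
rewrite expr2 -mulrA mul_rem_sinh /sinh /GRing.scale /= [- q * (T - t)]mulNr.
by field.
Qed.

Lemma is_derive_rem_sinh (t : R) : is_derive t 1 rem_sinh (- rem_cosh t).
Proof.
have [q0|q0] := eqVneq q 0.
  have -> : rem_sinh = cst T - id.
    by apply/funext => r; rewrite /rem_sinh q0 mul0r /sinhc eqxx mulr1.
  apply: is_derive_eq.
  by rewrite /rem_cosh q0 mul0r /cosh oppr0 expR0 sub0r; lra.
have h1 := is_derive_expR_aff q t; have h2 := is_derive_expR_aff (- q) t.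
have -> : rem_sinh = (q^-1 / 2) \*: ((fun r => expR (q * (T - r))) -
                         (fun r => expR (- q * (T - r)))).
  apply/funext => r; rewrite -[LHS](mulKf q0) mul_rem_sinh /sinh /= !fctE mulNr.
  by rewrite /GRing.scale /= mulrAC mulrA.
apply: is_derive_eq.
by rewrite /rem_cosh /cosh /GRing.scale /= [- q * (T - t)]mulNr; field.
Qed.

End remaining_time.

(** The friction is the logarithmic derivative in t of
    1 / (rem_cosh rem_sinh^3), which is what makes it both integrable in closed
    form and compatible with the energy below. *)
Lemma nag_g_dampingE (R : realType) (mu T t : R) : t < T ->
  let q := Num.sqrt mu / 2 in
  nag_g_damping mu T t = q ^+ 2 * rem_sinh q T t / rem_cosh q T t
                         + 3 * rem_cosh q T t / rem_sinh q T t.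
Proof.
move=> tT q; rewrite /nag_g_damping -/q /tanh -mul_rem_sinh /cothc /tanhc.
rewrite -/(rem_cosh q T t).
rewrite /rem_sinh; set s := sinhc _; set c := rem_cosh _ _ _.
have s0 : s != 0 by rewrite gt_eqF// sinhc_gt0.
have c0 : c != 0 by rewrite gt_eqF// rem_cosh_gt0.
have t0 : T - t != 0 by rewrite subr_eq0 gt_eqF.
by field; rewrite s0 c0 t0.
Qed.

(** * Derivatives along curves *)

Section dot_theory.
Variables (R : realType) (n : nat).
Implicit Types u v w : 'rV[R]_n.

Lemma dotC u v : dot u v = dot v u.
Proof. by apply: eq_bigr => i _; rewrite mulrC. Qed.

Lemma dotDl u v w : dot (u + v) w = dot u w + dot v w.
Proof. by rewrite -big_split; apply: eq_bigr => i _; rewrite !mxE mulrDl. Qed.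

Lemma dotZl a u v : dot (a *: u) v = a * dot u v.
Proof. by rewrite mulr_sumr; apply: eq_bigr => i _; rewrite !mxE mulrA. Qed.

Lemma dotNl u v : dot (- u) v = - dot u v.
Proof. by rewrite -scaleN1r dotZl mulN1r. Qed.

Lemma dot_ge0 u : 0 <= dot u u.
Proof. by apply: sumr_ge0 => i _; rewrite -expr2 sqr_ge0. Qed.

Lemma enorm_sqr u : enorm u ^+ 2 = dot u u.
Proof. by rewrite sqr_sqrtr // dot_ge0. Qed.

Lemma cvg_coord (F : set_system R) (FF : Filter F) (U : R -> 'rV[R]_n) u i :
  U r @[r --> F] --> u -> U r 0 i @[r --> F] --> u 0 i.
Proof.
move=> Uu; apply: (@cvg_comp _ _ _ U (fun M : 'rV[R]_n => M 0 i) _ _ _ Uu).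
exact: coord_continuous.
Qed.

Lemma cvg_dot (F : set_system R) (FF : Filter F) (U W : R -> 'rV[R]_n) u w :
  (forall i, U r 0 i @[r --> F] --> u 0 i) ->
  (forall i, W r 0 i @[r --> F] --> w 0 i) ->
  dot (U r) (W r) @[r --> F] --> dot u w.
Proof.
move=> Uu Ww; apply: cvg_big => [|i _]; last exact: cvgM.
exact: add_continuous.
Qed.

Lemma is_derive_coord (U : R -> 'rV[R]_n) (t : R) u i :
  is_derive t 1 U u -> is_derive t 1 (fun r => U r 0 i) (u 0 i).
Proof.
move=> [dU <-]; apply: DeriveDef; first by move/derivable_mxP : dU; apply.
by rewrite derive_mx // mxE.
Qed.

Lemma is_derive_dot (U W : R -> 'rV[R]_n) (t : R) u w :
  is_derive t 1 U u -> is_derive t 1 W w ->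
  is_derive t 1 (fun r => dot (U r) (W r)) (dot u (W t) + dot (U t) w).
Proof.
move=> dU dW.
have -> : (fun r => dot (U r) (W r)) =
    \sum_(i < n) ((fun r => U r 0 i) * (fun r => W r 0 i)).
  by apply/funext => r; rewrite fct_sumE.
have di i := is_deriveM (is_derive_coord i dU) (is_derive_coord i dW).
apply: (is_derive_eq (is_derive_sum di)).
rewrite /dot -big_split; apply: eq_bigr => i _ /=.
by rewrite /GRing.scale /= addrC [u 0 i * _]mulrC.
Qed.

Lemma diff_grad (f : 'rV[R]_n -> R) x v : differentiable f x ->
  'd f x v = dot (grad f x) v.
Proof.
move=> df; rewrite {1}(row_sum_delta v) linear_sum; apply: eq_bigr => i _ /=.
by rewrite linearZ /= mxE -deriveE // mulrC.
Qed.

Lemma is_derive_comp_grad (f : 'rV[R]_n -> R) (U : R -> 'rV[R]_n) (t : R) u :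
  differentiable f (U t) -> is_derive t 1 U u ->
  is_derive t 1 (f \o U) (dot (grad f (U t)) u).
Proof.
move=> df [/derivable1_diffP dU <-].
apply: DeriveDef.
  by apply/derivable1_diffP; exact: differentiable_comp.
rewrite deriveE; last exact: differentiable_comp.
by rewrite diff_comp //= diff_grad // deriveE.
Qed.

Lemma is_derive_within (D : set R) (U : R -> 'rV[R]_n) (t : R) u :
  nbhs t D -> has_derivative_within D U t u -> is_derive t 1 U u.
Proof.
move=> Dt dU.
have H : h^-1 *: ((U \o shift t) (h *: (1:R)) - U t) @[h --> 0^'] --> u.
  have H1 : h%:A + t @[h --> 0^'] --> within D (t^').
    move=> P tP.
    have {}tP : nbhs t [set r | r != t -> D r -> P r] := tP.
    have {tP Dt} : \forall r \near t, r != t -> P r.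
      by apply: (filterS2 _ _ tP Dt) => r rP Dr rt; exact: rP.
    rewrite (near_shift 0) subr0 => tP.
    change (nbhs (0 : R) [set h | h != 0 -> P (h%:A + t)]).
    apply: filterS tP => h /= hP h0; rewrite /GRing.scale /= mulr1.
    by apply: hP; rewrite -subr_eq0 addrK.
  have := cvg_comp _ _ H1 dU.
  apply: cvg_trans; apply: near_eq_cvg; near=> h => /=.
  by rewrite addrK /GRing.scale /= mulr1.
apply: DeriveDef; first by apply/cvg_ex; exists u.
exact: cvg_lim.
Unshelve. all: by end_near.
Qed.

Lemma within_cvg_right (D : set R) (U : R -> 'rV[R]_n) (t : R) u :
  (\forall r \near t^'+, D r) -> has_derivative_within D U t u ->
  U r @[r --> t^'+] --> U t.
Proof.
move=> tD dU.
have dU' : (r - t)^-1 *: (U r - U t) @[r --> t^'+] --> u.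
  apply: cvg_trans dU => P tP.
  have {}tP : \forall r \near t^'+,
      r != t -> D r -> P ((r - t)^-1 *: (U r - U t)).
    exact: cvg_within.
  by apply: (filterS3 _ _ tP tD (nbhs_right_neq t)) => r rP Dr rt; exact: rP.
have dr : r - t @[r --> t^'+] --> 0.
  apply: cvg_at_right_filter; rewrite -(subrr t).
  by apply: (@cvgB _ _ _ (nbhs t) _ id (cst t)); [exact: cvg_id|exact: cvg_cst].
have UD : U t + (r - t) *: ((r - t)^-1 *: (U r - U t)) @[r --> t^'+] --> U t.
  rewrite -[X in _ --> X]addr0 -(scale0r u).
  by apply: cvgD; [exact: cvg_cst|exact: cvgZ].
apply: cvg_trans UD; apply: near_eq_cvg; near=> r => /=.
have rt : r - t != 0 by rewrite subr_eq0 gt_eqF.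
by rewrite scalerA mulfV // scale1r addrC subrK.
Unshelve. all: by end_near. Qed.

End dot_theory.

(** * Monotonicity and the rule of L'Hopital at infinity *)

Section calculus.
Variable R : realType.
Implicit Types (f df g dg : R -> R) (a b l : R).

Lemma derive_le0_le f df a b : a < b ->
  (forall x, a < x < b -> is_derive x 1 f (df x)) ->
  (forall x, a < x < b -> df x <= 0) ->
  {within `[a, b], continuous f} -> f b <= f a.
Proof.
move=> ab fdf df0 cf.
have [c] := @MVT _ f df a b ab (fun x xab => fdf x xab) cf.
rewrite in_itv /= => cab fE; rewrite -subr_le0 fE.
by rewrite mulr_le0_ge0 ?df0// subr_ge0 ltW.
Qed.

Lemma is_derive_continuous f (x d : R) :
  is_derive x 1 f d -> {for x, continuous f}.
Proof. by move=> [/derivable1_diffP/differentiable_continuous]. Qed.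

(** The function f - m g is nonincreasing, hence bounded above near b by its
    value K at a midpoint; dividing by g leaves the error K / g, which is
    eventually below e. *)
Lemma quotient_le_near_left f df g dg a b m e : a < b -> 0 < e ->
  (forall x, a < x < b -> is_derive x 1 f (df x)) ->
  (forall x, a < x < b -> is_derive x 1 g (dg x)) ->
  g x @[x --> b^'-] --> +oo ->
  (forall x, a < x < b -> df x <= m * dg x) ->
  \forall x \near b^'-, f x / g x <= m + e.
Proof.
move=> ab e0 fdf gdg goo fg.
pose d := (a + b) / 2; have [ad db] : a < d /\ d < b by rewrite /d; lra.
pose K := f d - m * g d.
have hder x : a < x < b -> is_derive x 1 (f - m \*: g) (df x - m * dg x).
  move=> xab; have df_ := fdf x xab; have dg_ := gdg x xab.
  exact: is_derive_eq.
have fK x : d < x -> x < b -> f x - m * g x <= K.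
  move=> dx xb.
  apply: (@derive_le0_le (f - m \*: g) (fun x => df x - m * dg x) d x dx).
  - move=> y /andP[dy yx]; apply: hder.
    by rewrite (lt_trans ad)//= (lt_trans yx).
  - move=> y /andP[dy yx]; rewrite subr_le0 fg// (lt_trans ad)//=.
    exact: lt_trans xb.
  - apply: derivable_within_continuous => y; rewrite in_itv /= => /andP[dy yx].
    have /hder[//] : a < y < b.
    by rewrite (lt_le_trans ad)//= (le_lt_trans yx).
near=> x.
have dx : d < x by near: x; exact: nbhs_left_gt.
have xb : x < b by near: x; exact: nbhs_left_lt.
have g1 : 1 <= g x by near: x; move/cvgryPge : goo; apply.
have gK : K / e <= g x by near: x; move/cvgryPge : goo; apply.
have g0 : 0 < g x by apply: lt_le_trans g1.
rewrite ler_pdivrMr// mulrDl addrC -lerBlDr (le_trans (fK x dx xb))//.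
by rewrite mulrC -ler_pdivrMr.
Unshelve. all: by end_near. Qed.

(** Only the denominator is assumed to tend to infinity: the numerator may be
    arbitrary, which is essential when it is not known to have a limit. *)
Lemma lhopital_pinfty_at_left f df g dg a b l : a < b ->
  (forall x, a < x < b -> is_derive x 1 f (df x)) ->
  (forall x, a < x < b -> is_derive x 1 g (dg x)) ->
  g x @[x --> b^'-] --> +oo ->
  (forall x, a < x < b -> 0 < dg x) ->
  df x / dg x @[x --> b^'-] --> l -> f x / g x @[x --> b^'-] --> l.
Proof.
move=> ab fdf gdg goo dg0 dfgl; apply/cvgrPdist_le => e e0.
have e2 : 0 < e / 2 by rewrite divr_gt0.
have [c /andP[ac cb] cl] : exists2 c, a < c < b &
    forall x, c < x < b -> `|l - df x / dg x| <= e / 2.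
  have := (cvgrPdist_le _ _).1 dfgl _ e2.
  move=> [r /= r0 rl].
  exists (Num.max ((a + b) / 2) (b - r / 2)).
    rewrite lt_max gt_max.
    by apply/andP; split; [apply/orP; left|apply/andP; split]; lra.
  move=> x; rewrite gt_max => /andP[/andP[_ bx] xb].
  by apply: rl => //=; rewrite ger0_norm; lra.
have sub x : c < x < b -> a < x < b.
  by move=> /andP[cx ->]; rewrite (lt_trans ac).
have dfle x : c < x < b -> df x <= (l + e / 2) * dg x.
  move=> cxb; rewrite -ler_pdivrMr ?dg0 ?sub//.
  by have := cl x cxb; rewrite ler_norml; lra.
have dfge x : c < x < b -> - df x <= (- l + e / 2) * dg x.
  move=> cxb; rewrite -ler_pdivrMr ?dg0 ?sub// mulNr.
  by have := cl x cxb; rewrite ler_norml; lra.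
have U := @quotient_le_near_left f df g dg c b (l + e / 2) (e / 2) cb e2
  (fun x h => fdf x (sub x h)) (fun x h => gdg x (sub x h)) goo dfle.
have fdfN x : c < x < b -> is_derive x 1 (- f) (- df x).
  by move=> cxb; have dfx := fdf x (sub x cxb); exact: is_deriveN.
have L := @quotient_le_near_left (- f) (fun x => - df x) g dg c b (- l + e / 2)
  (e / 2) cb e2 fdfN (fun x h => gdg x (sub x h)) goo dfge.
apply: (filterS2 _ _ U L) => x Ux; rewrite fctE mulNr => Lx.
by rewrite ler_norml; lra.
Qed.

End calculus.

(** * The energy of the flow *)

Section flow.
Variables (R : realType) (n : nat) (q T : R) (f : 'rV[R]_n -> R).
Variables X V A : R -> 'rV[R]_n.
Hypothesis T_gt0 : 0 < T.
Hypothesis df : forall x, differentiable f x.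
Hypothesis cgrad : continuous (grad f).
Hypothesis conv : strongly_convex (4 * q ^+ 2) f.
Hypothesis dX : forall t : R, 0 < t < T -> is_derive t 1 X (V t).
Hypothesis dV : forall t : R, 0 < t < T -> is_derive t 1 V (A t).
Hypothesis ode : forall t : R, 0 < t < T ->
  A t = - ((q ^+ 2 * rem_sinh q T t / rem_cosh q T t
            + 3 * rem_cosh q T t / rem_sinh q T t) *: V t + grad f (X t)).
Hypothesis cvgX0 : X t @[t --> 0^'+] --> X 0.
Hypothesis cvgV0 : V t @[t --> 0^'+] --> V 0.
Hypothesis V0 : V 0 = 0.
Hypothesis cvgXT : X t @[t --> T^'-] --> X T.

Let c := rem_cosh q T.
Let s := rem_sinh q T.
Let Y t := X t - X T.

Let c_neq0 t : c t != 0. Proof. by rewrite gt_eqF// rem_cosh_gt0. Qed.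
Let s_neq0 t : t < T -> s t != 0.
Proof. by move=> tT; rewrite gt_eqF// rem_sinh_gt0. Qed.

Definition energy (t : R) : R :=
  (s t)^-1 ^+ 2 * (f (X t) - f (X T) + 2^-1 * dot (V t) (V t)
    + 2 * (c t * (s t)^-1 * dot (V t) (Y t)) + 2 * q ^+ 2 * dot (Y t) (Y t)).

Definition energy_rate (t : R) : R :=
  2 * c t * (s t)^-1 ^+ 3 * (f (X t) - f (X T) - dot (grad f (X t)) (Y t)
    + 2 * q ^+ 2 * dot (Y t) (Y t)) - q ^+ 2 * (s t)^-1 / c t * dot (V t) (V t).

Lemma is_derive_rem_sinhV (t : R) : t < T ->
  is_derive t 1 (fun r => (s r)^-1) (c t * (s t)^-1 ^+ 2).
Proof.
move=> tT; have ds := is_derive_rem_sinh q T t.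
have := @is_deriveV _ s t _ 1 (s_neq0 tT) ds.
by rewrite /GRing.scale /= mulrN mulNr opprK exprVn mulrC.
Qed.

(** The weights of the energy are chosen so that the terms in <V, grad f> and
    <V, Y> cancel once the square of rem_cosh is eliminated through
    rem_cosh^2 = 1 + q^2 rem_sinh^2. *)
Lemma is_derive_energy (t : R) : 0 < t < T ->
  is_derive t 1 energy (energy_rate t).
Proof.
move=> t0T; have /andP[t0 tT] := t0T.
have dXt := dX t0T; have dVt := dV t0T.
have dY : is_derive t 1 Y (V t).
  by have := @is_deriveB _ _ _ X (cst (X T)) t 1 (V t) 0; rewrite subr0; apply.
have dF := is_derive_comp_grad (df (X t)) dXt.
have dVV := is_derive_dot dVt dVt.
have dVY := is_derive_dot dVt dY.
have dYY := is_derive_dot dY dY.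
have dw := is_derive_rem_sinhV tT.
have dc := is_derive_rem_cosh q T t.
have -> : energy = (fun r => (s r)^-1) ^+ 2 * ((f \o X) - cst (f (X T))
    + 2^-1 \*: (fun r => dot (V r) (V r))
    + 2 \*: (c * (fun r => (s r)^-1) * (fun r => dot (V r) (Y r)))
    + (2 * q ^+ 2) \*: (fun r => dot (Y r) (Y r))).
  by [].
apply: is_derive_eq.
rewrite /energy_rate /= !fctE /GRing.scale /= /GRing.scale /=.
rewrite (dotC (V t) (A t)) (dotC (Y t) (V t)) (ode t0T).
move: (dot (Y t) (Y t)) => yy; rewrite !(dotNl, dotDl, dotZl).
have cE := rem_cosh_sqr q T t; rewrite -/c -/s in cE *.
have c0 := c_neq0 t; have s0 := s_neq0 tT.
move: (dot (V t) (V t)) (dot (V t) (Y t)) (dot (grad f (X t)) (Y t))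
  (dot (grad f (X t)) (V t)) (c t) (s t) cE c0 s0 => vv vy gy gv C S cE C0 S0.
by field: cE; rewrite C0 S0.
Qed.

(** The bracket that multiplies 2 c / s^3 is nonpositive by strong convexity,
    compared between X t and X T. *)
Lemma energy_rate_le0 (t : R) : t < T -> energy_rate t <= 0.
Proof.
move=> tT; rewrite /energy_rate.
have c0 : 0 < c t := rem_cosh_gt0 q T t; have s0 : 0 < (s t)^-1.
  by rewrite invr_gt0 rem_sinh_gt0.
have h : f (X t) - f (X T) - dot (grad f (X t)) (Y t)
    + 2 * q ^+ 2 * dot (Y t) (Y t) <= 0.
  have := conv (X t) (X T); rewrite enorm_sqr.
  have -> : X T - X t = - Y t by rewrite opprB.
  rewrite (dotC (grad f _)) !dotNl (dotC (Y t) (- Y t)) dotNl opprK.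
  by rewrite (dotC (Y t) (grad f _)); lra.
rewrite subr_le0; apply: (@le_trans _ _ 0).
  by rewrite mulr_ge0_le0// !mulr_ge0 ?exprn_ge0// ltW.
rewrite mulr_ge0 ?dot_ge0// mulr_ge0 ?invr_ge0 ?(ltW c0)//.
by rewrite mulr_ge0 ?sqr_ge0// ltW.
Qed.

Let cvg_c (t : R) : c r @[r --> t] --> c t.
Proof. exact: is_derive_continuous (is_derive_rem_cosh q T t). Qed.

Let cvg_s (t : R) : s r @[r --> t] --> s t.
Proof. exact: is_derive_continuous (is_derive_rem_sinh q T t). Qed.

(** At t = 0 the equation gives one-sided information only, so the monotonicity
    of the energy is carried to the endpoint by this limit. *)
Lemma energy_cvg0 : energy r @[r --> 0^'+] --> energy 0.
Proof.
have cV i : V r 0 i @[r --> 0^'+] --> V 0 0 i by exact: cvg_coord cvgV0.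
have cY i : Y r 0 i @[r --> 0^'+] --> Y 0 0 i.
  apply: cvg_coord; apply: cvgB; [exact: cvgX0|exact: cvg_cst].
have cs : (s r)^-1 @[r --> 0^'+] --> (s 0)^-1.
  by apply: cvgV; [exact: s_neq0|apply: cvg_at_right_filter; exact: cvg_s].
have cc : c r @[r --> 0^'+] --> c 0 by apply: cvg_at_right_filter; exact: cvg_c.
have cf : f (X r) @[r --> 0^'+] --> f (X 0).
  apply: (cvg_comp _ _ cvgX0); exact: (differentiable_continuous (df (X 0))).
apply: cvgM; first by rewrite expr2; under eq_fun do rewrite expr2; exact: cvgM.
apply: cvgD; last by apply: cvgM; [exact: cvg_cst|exact: cvg_dot].
apply: cvgD; last first.
  apply: cvgM; first exact: cvg_cst.
  by apply: cvgM; [exact: cvgM|exact: cvg_dot].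
apply: cvgD; last by apply: cvgM; [exact: cvg_cst|exact: cvg_dot].
by apply: cvgB => //; exact: cvg_cst.
Qed.

Lemma energy_le (t : R) : 0 < t < T -> energy t <= energy 0.
Proof.
move=> /andP[t0 tT]; apply: (@derive_le0_le _ energy energy_rate 0 t t0).
- by move=> r /andP[r0 rt]; apply: is_derive_energy; rewrite r0 (lt_trans rt).
- by move=> r /andP[r0 rt]; apply: energy_rate_le0; rewrite (lt_trans rt).
have ce r : 0 < r < T -> {for r, continuous energy}.
  by move=> r0T; exact: is_derive_continuous (is_derive_energy r0T).
apply/continuous_within_itvP => //; split; last 1 first.
- by apply: cvg_at_left_filter; apply: ce; rewrite t0.
- move=> r; rewrite in_itv /= => /andP[r0 rt].
  by apply: ce; rewrite r0 (lt_trans rt).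
- exact: energy_cvg0.
Qed.

Lemma energy0 : energy 0 =
  (s 0)^-1 ^+ 2 *
  (f (X 0) - f (X T) + 2 * q ^+ 2 * dot (X 0 - X T) (X 0 - X T)).
Proof.
have dot0 u : dot (0 : 'rV[R]_n) u = 0 by rewrite -(scale0r 0) dotZl mul0r.
by rewrite /energy V0 !dot0 !mulr0 !addr0.
Qed.

(** * Behaviour at the terminal time *)

Let near0T : \forall t \near T^'-, 0 < t < T.
Proof.
near=> t; apply/andP; split; near: t; [exact: nbhs_left_gt|exact: nbhs_left_lt].
Unshelve. all: by end_near. Qed.

Let s_pinfty : (s t)^-1 ^+ 2 @[t --> T^'-] --> +oo.
Proof.
under eq_fun do rewrite exprVn.
apply/cvgrVy.
  by apply: filterS near0T => t /andP[_ tT]; rewrite exprn_gt0// rem_sinh_gt0.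
apply: cvg_at_left_filter; under eq_fun do rewrite expr2.
have s0 : s T = 0 := rem_sinh_end q T.
by rewrite -(mulr0 0) -{1 2}s0; apply: cvgM; exact: cvg_s.
Qed.

Let cT : c t @[t --> T^'-] --> (1 : R).
Proof.
by rewrite -(rem_cosh_end q T); apply: cvg_at_left_filter; exact: cvg_c.
Qed.

Let sT : s t @[t --> T^'-] --> (0 : R).
Proof.
by rewrite -(rem_sinh_end q T); apply: cvg_at_left_filter; exact: cvg_s.
Qed.

Let g := grad f (X T).

Let cvg_grad i : grad f (X t) 0 i @[t --> T^'-] --> g 0 i.
Proof. by apply: cvg_coord; apply: (cvg_comp _ _ cvgXT); exact: cgrad. Qed.

(** Dividing by c s^3 absorbs the friction, so the derivative of the quotient
    only sees grad f; it is compared with s^-2 / 2, which has derivative c / s^3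
    and tends to infinity. *)
Lemma velocity_asymptotics i : V t 0 i / s t @[t --> T^'-] --> - (g 0 i / 2).
Proof.
have NE (t : R) : 0 < t < T -> is_derive t 1
    (fun r => V r 0 i * ((c r)^-1 * (s r)^-1 ^+ 3))
    (- (grad f (X t) 0 i) * ((c t)^-1 * (s t)^-1 ^+ 3)).
  move=> t0T; have /andP[t0 tT] := t0T.
  have dVi := is_derive_coord i (dV t0T).
  have dw := is_derive_rem_sinhV tT.
  have dc := @is_deriveV _ c t _ 1 (c_neq0 t) (is_derive_rem_cosh q T t).
  have -> : (fun r => V r 0 i * ((c r)^-1 * (s r)^-1 ^+ 3)) =
    (fun r => V r 0 i) * ((fun r => (c r)^-1) * (fun r => (s r)^-1) ^+ 3) by [].
  apply: is_derive_eq.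
  rewrite (ode t0T) /= !fctE !mxE -/c -/s /GRing.scale /= /GRing.scale /=.
  have c0 := c_neq0 t; have s0 := s_neq0 tT.
  by field; rewrite c0 s0.
have DE (t : R) : 0 < t < T -> is_derive t 1
    (fun r => 2^-1 * (s r)^-1 ^+ 2) (c t * (s t)^-1 ^+ 3).
  move=> /andP[t0 tT]; have dw := is_derive_rem_sinhV tT.
  have -> : (fun r => 2^-1 * (s r)^-1 ^+ 2) =
    2^-1 \*: ((fun r => (s r)^-1) ^+ 2).
    by [].
  apply: is_derive_eq; rewrite /= /GRing.scale /= /GRing.scale /=.
  by have s0 := s_neq0 tT; field.
have Doo : 2^-1 * (s r)^-1 ^+ 2 @[r --> T^'-] --> +oo.
  by apply: gt0_cvgMry; [rewrite invr_gt0|exact: s_pinfty].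
have lh : V t 0 i * ((c t)^-1 * (s t)^-1 ^+ 3) / (2^-1 * (s t)^-1 ^+ 2)
    @[t --> T^'-] --> - g 0 i.
  apply: (lhopital_pinfty_at_left T_gt0 NE DE Doo).
    move=> t /andP[_ tT]; have c0 := rem_cosh_gt0 q T t.
    by rewrite mulr_gt0// exprn_gt0// invr_gt0 rem_sinh_gt0.
  have : - grad f (X t) 0 i * ((c t)^-1 * (c t)^-1) @[t --> T^'-] --> - g 0 i.
    have -> : - g 0 i = - g 0 i * (1^-1 * 1^-1) by rewrite invr1 !mulr1.
    apply: cvgM; first by apply: cvgN; exact: cvg_grad.
    by apply: cvgM; apply: cvgV => //; exact: oner_neq0.
  apply: cvg_trans; apply: near_eq_cvg; apply: filterS near0T => t /andP[_ tT].
  have c0 := c_neq0 t; have s0 := s_neq0 tT.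
  by field; rewrite c0 s0.
have : 2^-1 * (c t *
      (V t 0 i * ((c t)^-1 * (s t)^-1 ^+ 3) / (2^-1 * (s t)^-1 ^+ 2)))
    @[t --> T^'-] --> 2^-1 * (1 * - g 0 i).
  by apply: cvgM; [exact: cvg_cst|exact: cvgM].
rewrite mul1r mulrN mulrC; apply: cvg_trans; apply: near_eq_cvg.
apply: filterS near0T => t /andP[_ tT].
have c0 := c_neq0 t; have s0 := s_neq0 tT.
by field; rewrite c0 s0.
Qed.

(** The ratio of the derivatives V and (s^2)' = - 2 s c is governed by
    [velocity_asymptotics]. *)
Lemma displacement_asymptotics i :
  Y t 0 i / s t ^+ 2 @[t --> T^'-] --> g 0 i / 4.
Proof.
apply: (@lhopital_at_left _ _ (fun t => V t 0 i) _
  (fun t => - (2 * s t * c t)) 0 T _ T_gt0).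
- move=> t; rewrite in_itv /= => t0T.
  have -> : (fun r => Y r 0 i) = (fun r => X r 0 i) - cst (X T 0 i).
    by apply/funext => r; rewrite /Y !mxE.
  have dXi := is_derive_coord i (dX t0T).
  by apply: is_derive_eq; rewrite subr0.
- move=> t _; have ds := is_derive_rem_sinh q T t.
  have -> : (fun r => s r ^+ 2) = s ^+ 2 by [].
  by apply: is_derive_eq; rewrite /GRing.scale /= expr1 mulrN.
- have -> : (0 : R) = (X T - X T) 0 i by rewrite subrr mxE.
  by apply: cvg_coord; apply: cvgB; [exact: cvgXT|exact: cvg_cst].
- by under eq_fun do rewrite expr2; rewrite -(mulr0 0); apply: cvgM.
- move=> t; rewrite in_itv /= => /andP[_ tT].
  rewrite oppr_eq0; apply: mulf_neq0 => //.
  by apply: mulf_neq0; rewrite ?pnatr_eq0 ?s_neq0.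
have : V t 0 i / s t * - (2^-1 * (c t)^-1) @[t --> T^'-]
    --> - (g 0 i / 2) * - (2^-1 * 1^-1).
  apply: cvgM; first exact: velocity_asymptotics.
  apply: cvgN; apply: cvgM; first exact: cvg_cst.
  by apply: cvgV => //; exact: oner_neq0.
have -> : - (g 0 i / 2) * - (2^-1 * 1^-1) = g 0 i / 4 by field.
apply: cvg_trans; apply: near_eq_cvg.
apply: filterS near0T => t /andP[_ tT].
have c0 := c_neq0 t; have s0 := s_neq0 tT.
by field; rewrite c0 s0.
Qed.

(** The gap f (X t) - f (X T) is bounded below by convexity at X T, so that its
    second-order expansion is avoided; the three remaining terms of the energy
    contribute |g|^2 / 4 + |g|^2 / 8 - |g|^2 / 4. *)
Lemma energy_terminal : dot g g / 8 <= energy 0.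
Proof.
pose v t := (s t)^-1 *: V t; pose y t := (s t)^-1 ^+ 2 *: Y t.
(* What remains of the energy after this bound, in the rescaled variables. *)
pose lo t := dot g (y t) + 2^-1 * dot (v t) (v t) + 2 * (c t * dot (v t) (y t)).
have cv i : v t 0 i @[t --> T^'-] --> (- 2^-1 *: g) 0 i.
  have -> : (- 2^-1 *: g) 0 i = - (g 0 i / 2) by rewrite mxE mulNr mulrC.
  apply: cvg_trans (@velocity_asymptotics i).
  by apply: near_eq_cvg; apply: nearW => t; rewrite mxE mulrC.
have cy i : y t 0 i @[t --> T^'-] --> (4^-1 *: g) 0 i.
  have -> : (4^-1 *: g) 0 i = g 0 i / 4 by rewrite mxE mulrC.
  apply: cvg_trans (@displacement_asymptotics i).
  apply: near_eq_cvg; apply: nearW => t.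
  by rewrite /= mulrC -exprVn [in RHS]mxE.
have clo : lo t @[t --> T^'-] --> dot g g / 8.
  have -> : dot g g / 8 = dot g (4^-1 *: g)
     + 2^-1 * dot (- 2^-1 *: g) (- 2^-1 *: g)
     + 2 * (1 * dot (- 2^-1 *: g) (4^-1 *: g)).
    rewrite !dotZl !(dotC g (_ *: _)) !dotZl; by field.
  apply: cvgD; last first.
    by apply: cvgM; [exact: cvg_cst|apply: cvgM => //; exact: cvg_dot].
  apply: cvgD; last by apply: cvgM; [exact: cvg_cst|exact: cvg_dot].
  by apply: cvg_dot => // i; exact: cvg_cst.
apply: (ler_cvg_to clo (cvg_cst (energy 0))).
apply: filterS near0T => t t0T; apply: le_trans (energy_le t0T).
have /andP[_ tT] := t0T; have s0 := s_neq0 tT.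
have := conv (X T) (X t); rewrite enorm_sqr -/g -/(Y t) => fX.
have yy : 0 <= q ^+ 2 * dot (Y t) (Y t) by rewrite mulr_ge0 ?sqr_ge0 ?dot_ge0.
rewrite /lo /energy /v /y (dotC g) !dotZl (dotC (V t) (_ *: _)) !dotZl.
rewrite (dotC (V t) (_ *: _)) !dotZl (dotC (Y t) (V t)) (dotC (Y t) g).
rewrite -subr_ge0.
set E := (X in 0 <= X).
have -> : E = (s t)^-1 ^+ 2 *
   (f (X t) - f (X T) - dot g (Y t) + 2 * (q ^+ 2 * dot (Y t) (Y t))).
  by rewrite /E; field.
by rewrite mulr_ge0 ?sqr_ge0//; lra.
Qed.

End flow.

(** * The gradient bound *)

Theorem corollary20 (R : realType) (n : nat) (T mu s : R) (x0 : 'rV[R]_n)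
    (f : 'rV[R]_n -> R) (xstar : 'rV[R]_n) (X : R -> 'rV[R]_n)
    (hT : 0 < T) (hmu : 0 <= mu) (hs : 0 < s)
    (hf : continuously_differentiable f)
    (hconv : strongly_convex mu f)
    (hsmooth : smooth (1 / s) f)
    (hmin : minimizer f xstar)
    (hX : nag_g_solution f mu T x0 X) :
  enorm (grad f (X T)) ^+ 2
    <= 8 / T ^+ 2 * cschc (Num.sqrt mu / 2 * T) ^+ 2
       * (f x0 - f (X T) + mu / 2 * enorm (x0 - X T) ^+ 2)
  /\
  8 / T ^+ 2 * cschc (Num.sqrt mu / 2 * T) ^+ 2
     * (f x0 - f (X T) + mu / 2 * enorm (x0 - X T) ^+ 2)
    <= 8 / T ^+ 2 * cschc (Num.sqrt mu / 2 * T) ^+ 2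
       * (f x0 - f xstar + mu / 2 * enorm (x0 - X T) ^+ 2).
Proof.
split; last first.
  apply: ler_wpM2l; first by rewrite mulr_ge0 ?sqr_ge0// divr_ge0 ?sqr_ge0.
  by rewrite lerD2r lerD2l lerN2; exact: hmin.
have [cX [V [A [X0 V0 dX dV ode]]]] := hX.
have [df cgrad] := hf.
pose q := Num.sqrt mu / 2.
have q2 : 4 * q ^+ 2 = mu by rewrite /q expr_div_n sqr_sqrtr//; field.
have Dnbhs t : 0 < t < T -> nbhs t [set` `[0, T[].
  move=> t0T; have : nbhs t [set` `]0, T[].
    by apply: open_nbhs_nbhs; split; [exact: interval_open|rewrite /= in_itv].
  by apply: filterS => r /=; rewrite !in_itv /= => /andP[/ltW -> ->].
have Din t : 0 < t < T -> t \in `[0, T[.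
  by rewrite in_itv /= => /andP[/ltW -> ->].
have D0 : \forall r \near 0^'+, [set` `[0, T[] r.
  near=> r; rewrite /= in_itv /=; apply/andP; split; near: r.
    exact: nbhs_right_ge.
  exact: nbhs_right_lt.
have in0 : 0 \in `[0, T[ by rewrite in_itv /= lexx.
have cX0 : X t @[t --> 0^'+] --> X 0 by apply: within_cvg_right D0 (dX _ in0).
have cV0 : V t @[t --> 0^'+] --> V 0 by apply: within_cvg_right D0 (dV _ in0).
have cXT : X t @[t --> T^'-] --> X T.
  by have /(continuous_within_itvP _ hT)[] := cX.
have := @energy_terminal R n q T f X V A hT df cgrad.
rewrite q2 => /(_ hconv).
move=> /(_ (fun t h => is_derive_within (Dnbhs t h) (dX t (Din t h)))).
move=> /(_ (fun t h => is_derive_within (Dnbhs t h) (dV t (Din t h)))).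
have odeE t : 0 < t < T ->
    A t = - ((q ^+ 2 * rem_sinh q T t / rem_cosh q T t
              + 3 * rem_cosh q T t / rem_sinh q T t) *: V t + grad f (X t)).
  move=> t0T; have /andP[_ tT] := t0T; rewrite -nag_g_dampingE//.
  by apply/eqP; rewrite -addr_eq0 addrA; apply/eqP; exact: ode (Din t t0T).
move=> /(_ odeE cX0 cV0 cXT).
rewrite energy0// X0 !enorm_sqr ler_pdivrMr// => le8.
have -> : mu / 2 = 2 * q ^+ 2 by rewrite -q2; field.
apply: (le_trans le8); rewrite -/q le_eqVlt; apply/orP; left; apply/eqP.
have T0 : T != 0 by rewrite gt_eqF.
have sc0 : sinhc (q * T) != 0 by rewrite gt_eqF// sinhc_gt0.
by rewrite /rem_sinh subr0 /cschc; field; rewrite T0 sc0.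
Unshelve. all: by end_near. Qed.
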